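(* Let $\mathbb{K}$ be a field with $\operatorname{char}(\mathbb{K})\neq 0$. Let $G=(V,E)$ be a finite, simple, connected graph with $V=\{1,\ldots,n\}$, $n\ge 3$, and let $\{c_1,\dots,c_m\}$ be a complete set of representatives of the twin classes of $G$. Put $u_i:=|\mathcal{T}(c_i)|$, $t_0:=0$ and $t_i:=\sum_{\ell=1}^{i}u_\ell$ for $i\in\{1,\dots,m\}$, and assume that the vertices of $G$ are labeled in such a way that $\mathcal{T}(c_i)=\{t_{i-1}+1,\dots,t_i\}$ for every $i\in\{1,\dots,m\}$. Let $d\in\mathcal{L}_{\mathbb{K}}(\mathcal{A}(G))$ with matrix $(d_{ij})$, i.e. $d(e_i)=\sum_{k=1}^n d_{ik}e_k$. Then $d\in\operatorname{Der}_{\mathbb{K}}(\mathcal{A}(G))$ if, and only if, $d$ satisfies the following conditions: (i) $d$ is a block matrix of the form $$d=\left(\begin{array}{cccc} C_1&0&\dots&0\\ 0&C_2&\dots&0\\ \vdots&\vdots&\ddots&\vdots\\ 0&0&\dots&C_m\end{array}\right),$$ where $C_i\in M_{u_i}(\mathbb{K})$ for $i\in\{1,\dots,m\}$. (ii) If $j\in\mathcal{T}(c_i)$, with $i\in\{1,\dots,m\}$, then $$\sum_{k\in\mathcal{T}(c_i)}d_{kj}=2d_{tt}\quad\text{for all } t\in\mathcal{N}(\mathcal{T}(c_i)).$$ (iii) For every $i\in\{1,\dots,m\}$, the matrix $\overline{C_i}$ is skew-symmetric.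
   Context: A graph $G=(V,E)$ has vertex set $V=\{1,\ldots,n\}$; it is finite, simple (no loops, no multiple edges) and connected. $\mathcal{N}(i)$ is the set of neighbors of the vertex $i$, and for $U\subset V$, $\mathcal{N}(U):=\{j\in V: j\in\mathcal{N}(i)\text{ for some } i\in U\}$. The adjacency matrix is $A_G=(a_{ij})$ with $a_{ij}=1$ if $i\in\mathcal{N}(j)$ and $a_{ij}=0$ otherwise. Vertices $i,j$ are twins, written $i\sim_t j$, if $\mathcal{N}(i)=\mathcal{N}(j)$; this is an equivalence relation, and the twin class of $i$ is $\mathcal{T}(i)=\{j\in V: i\sim_t j\}$. The evolution algebra $\mathcal{A}(G)$ over $\mathbb{K}$ associated to $G$ is the $\mathbb{K}$-algebra with basis $\{e_i:i\in V\}$ and product determined by $e_i\cdot e_i=\sum_{k\in V}a_{ik}e_k$ for $i\in V$ and $e_i\cdot e_j=0$ for $i\neq j$. $\mathcal{L}_{\mathbb{K}}(\mathcal{A}(G))$ is the space of $\mathbb{K}$-linear operators on $\mathcal{A}(G)$. A derivation is a $d\in\mathcal{L}_{\mathbb{K}}(\mathcal{A}(G))$ such that $d(u\cdot v)=d(u)\cdot v+u\cdot d(v)$ for all $u,v\in\mathcal{A}(G)$; $\operatorname{Der}_{\mathbb{K}}(\mathcal{A}(G))$ is the space of all derivations. A linear operator $d$ is identified with the matrix $(d_{ij})$ given by $d(e_i)=\sum_{k=1}^n d_{ik}e_k$. For a square matrix $C=(c_{ij})$ over $\mathbb{K}$, $\overline{C}=(\overline{c}_{ij})$ denotes the matrix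 with $\overline{c}_{ij}=c_{ij}$ if $i\neq j$ and $\overline{c}_{ii}=0$. A matrix $M$ is skew-symmetric if $M^{T}=-M$. *)

(* Defs.v *)
From HB Require Import structures.
From mathcomp Require Import all_boot all_order all_algebra.

Set Implicit Arguments.
Unset Strict Implicit.
Unset Printing Implicit Defensive.

Import GRing.Theory.
Local Open Scope ring_scope.

(* A graph on n vertices is an adjacency relation on 'I_n, so vertices are
   numbered from 0 rather than from 1. *)

Definition simple_graph (n : nat) (e : rel 'I_n) : Prop :=
  symmetric e /\ irreflexive e.

Definition connected_graph (n : nat) (e : rel 'I_n) : Prop :=
  forall v w : 'I_n, connect e v w.

Definition neighbors (n : nat) (e : rel 'I_n) (i : 'I_n) : {set 'I_n} :=
  [set j | e i j].

Definition set_neighbors (n : nat) (e : rel 'I_n) (U : {set 'I_n}) :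
    {set 'I_n} :=
  [set j | [exists i in U, j \in neighbors e i]].

Definition adjacency_mx (K : fieldType) (n : nat) (e : rel 'I_n) : 'M[K]_n :=
  \matrix_(i, j) (if i \in neighbors e j then 1 else 0).

Definition twins (n : nat) (e : rel 'I_n) : rel 'I_n :=
  fun i j => neighbors e i == neighbors e j.

Definition twin_class (n : nat) (e : rel 'I_n) (i : 'I_n) : {set 'I_n} :=
  [set j | twins e i j].

Definition complete_twin_reps (n m : nat) (e : rel 'I_n)
    (c : 'I_m -> 'I_n) : Prop :=
  forall v : 'I_n, exists! i : 'I_m, v \in twin_class e (c i).

Definition twin_size (n m : nat) (e : rel 'I_n) (c : 'I_m -> 'I_n)
    (i : 'I_m) : nat :=
  #|twin_class e (c i)|.

(* twin_offset e c k is u_1 + ... + u_k; since 'I_m starts at 0, the sizes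
   involved are those of the indices l < k. *)
Definition twin_offset (n m : nat) (e : rel 'I_n) (c : 'I_m -> 'I_n)
    (k : nat) : nat :=
  (\sum_(l < m | (l < k)%N) twin_size e c l)%N.

Definition twin_labeled (n m : nat) (e : rel 'I_n) (c : 'I_m -> 'I_n) : Prop :=
  forall i : 'I_m, twin_class e (c i) =
    [set v : 'I_n | (twin_offset e c i <= v < twin_offset e c i.+1)%N].

(* Makes the block matrix with blocks of sizes u_i an n x n matrix. *)
Lemma sum_twin_size (n m : nat) (e : rel 'I_n) (c : 'I_m -> 'I_n) :
  complete_twin_reps e c -> (\sum_(i < m) twin_size e c i)%N = n.
Proof.
move=> hc; rewrite /twin_size.
under eq_bigr => i _ do rewrite -sum1_card big_mkcond /=.
rewrite exchange_big /= -[RHS]card_ord -sum1_card; apply: eq_bigr => v _.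
have [i [vi uniq_i]] := hc v.
rewrite (bigD1 i) //= vi big1 // => j neq_ji.
by case: ifP => // vj; rewrite (uniq_i j vj) eqxx in neq_ji.
Qed.

(* The evolution algebra has carrier 'rV[K]_n; its product is not associative
   in general, hence is a plain operation and not a ring structure. *)

Definition evol_basis (K : fieldType) (n : nat) (i : 'I_n) : 'rV[K]_n :=
  delta_mx 0 i.

Definition evol_basis_mul (K : fieldType) (n : nat) (e : rel 'I_n)
    (i j : 'I_n) : 'rV[K]_n :=
  if i == j then \sum_k adjacency_mx K e i k *: evol_basis K k else 0.

Definition evol_mul (K : fieldType) (n : nat) (e : rel 'I_n)
    (u v : 'rV[K]_n) : 'rV[K]_n :=
  \sum_i \sum_j (u 0 i * v 0 j) *: evol_basis_mul K e i j.

Lemma evol_mul_basis (K : fieldType) (n : nat) (e : rel 'I_n) (i j : 'I_n) :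
  evol_mul e (evol_basis K i) (evol_basis K j) = evol_basis_mul K e i j.
Proof.
rewrite /evol_mul (bigD1 i) //= [X in _ + X]big1 ?addr0 => [|k neq_ki].
  rewrite (bigD1 j) //= [X in _ + X]big1 ?addr0 => [|k neq_kj].
    by rewrite !mxE !eqxx mulr1 scale1r.
  by rewrite !mxE eqxx /= (negPf neq_kj) mulr0 scale0r.
by apply: big1 => l _; rewrite !mxE eqxx /= (negPf neq_ki) mul0r scale0r.
Qed.

Definition derivation (K : fieldType) (n : nat) (e : rel 'I_n)
    (d : {linear 'rV[K]_n -> 'rV[K]_n}) : Prop :=
  forall u v : 'rV[K]_n,
    d (evol_mul e u v) = evol_mul e (d u) v + evol_mul e u (d v).

(* Row i of lin1_mx d holds the coordinates of the image of the i-th basis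
   vector, so this is the convention d(e_i) = \sum_k d_ik e_k. *)
Lemma evol_opE (K : fieldType) (n : nat)
    (d : {linear 'rV[K]_n -> 'rV[K]_n}) (i : 'I_n) :
  d (evol_basis K i) = \sum_k lin1_mx d i k *: evol_basis K k.
Proof.
by rewrite [LHS]row_sum_delta; apply: eq_bigr => k _; rewrite !mxE.
Qed.

Definition zero_diag (K : fieldType) (u : nat) (C : 'M[K]_u) : 'M[K]_u :=
  \matrix_(i, j) (if i == j then 0 else C i j).

Definition skew_symmetric (K : fieldType) (u : nat) (M : 'M[K]_u) : Prop :=
  M^T = - M.

(* Main.v *)
Require Import Defs.
From HB Require Import structures.
From mathcomp Require Import all_boot all_order all_algebra.

Set Implicit Arguments.
Unset Strict Implicit.
Unset Printing Implicit Defensive.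

Import GRing.Theory.
Local Open Scope ring_scope.

(** Since e_i^2 is the sum of the basis vectors over N(i), comparing coordinates
    in the Leibniz rule on pairs of basis vectors ([derivation_coordP]) gives
    two families of equations for the matrix D of the operator:
    - for i <> j and all k, D_ij a_jk + D_ji a_ik = 0;
    - for all i and k, the sum of D_lk over l in N(i) is 2 D_ii a_ik.
    If i and j are not twins, some k is adjacent to exactly one of them, so one
    of D_ij, D_ji vanishes; the other then vanishes too, because in a connected
    graph with at least two vertices both i and j have a neighbor.  If i and j
    are distinct twins, any common neighbor k gives D_ij = - D_ji.  So the first
    family says that D is supported on pairs of twins, and skew-symmetric off
    the diagonal.  Once this is known, only the twins of k contribute to the sum
    in the second family, and they lie either all in N(i) or all outside it,
    according to whether i and k are adjacent.  Hence the second family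
    reduces to its instances with i adjacent to k, where the sum runs over the
    whole twin class of k.  This is [derivation_twinP].

    With the vertices of each twin class labeled consecutively, two vertices
    are twins exactly when they lie in the same diagonal block
    ([twins_block_index]), which turns support on pairs of twins into
    block-diagonality. *)

(** * Adjacency and twins *)

Lemma twinsP (n : nat) (e : rel 'I_n) (i j : 'I_n) :
  reflect (e i =1 e j) (twins e i j).
Proof.
apply: (iffP eqP) => [/setP eN k|eN]; first by have := eN k; rewrite !inE.
by apply/setP => k; rewrite !inE eN.
Qed.

Lemma twins_sym (n : nat) (e : rel 'I_n) : symmetric (twins e).
Proof. by move=> i j; rewrite /twins eq_sym. Qed.

Lemma twins_trans (n : nat) (e : rel 'I_n) : transitive (twins e).
Proof. by move=> j i k /eqP ij /eqP jk; rewrite /twins ij jk. Qed.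

Lemma connected_neighbor (n : nat) (e : rel 'I_n) (i : 'I_n) :
  (1 < n)%N -> connected_graph e -> exists k, e i k.
Proof.
move=> n_gt1 conn_e.
have [j neq_ji] : exists j : 'I_n, j != i.
  have: (0 < #|[set~ i]|)%N by rewrite cardsC1 card_ord -subn1 subn_gt0.
  by case/card_gt0P => j; rewrite !inE; exists j.
have /connectP[[|k p] /= pth def_j] := conn_e i j.
  by rewrite def_j eqxx in neq_ji.
by exists k; case/andP: pth.
Qed.

Lemma set_neighbors_twin_class (n : nat) (e : rel 'I_n) (i j t : 'I_n) :
  twins e i j -> (t \in set_neighbors e (twin_class e i)) = e j t.
Proof.
move=> tw_ij; rewrite inE; apply/existsP/idP => [[s]|e_jt].
  rewrite !inE => /andP[tw_is e_st].
  by rewrite -(twinsP _ _ _ tw_ij) (twinsP _ _ _ tw_is).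
by exists j; rewrite !inE tw_ij.
Qed.

(** * The Leibniz rule in coordinates *)

Lemma evol_mulE (K : fieldType) (n : nat) (e : rel 'I_n) (u v : 'rV[K]_n) k :
  symmetric e ->
  evol_mul e u v 0 k = \sum_i u 0 i * v 0 i * (e i k)%:R.
Proof.
move=> sym_e; rewrite /evol_mul summxE; apply: eq_bigr => i _.
rewrite summxE (bigD1 i) //= [X in _ + X]big1 ?addr0 => [|j neq_ji].
  rewrite mxE /evol_basis_mul eqxx summxE (bigD1 k) //= big1 ?addr0.
    by rewrite !mxE !eqxx mulr1 inE sym_e; case: (e i k).
  by move=> l neq_lk; rewrite !mxE eqxx /= eq_sym (negPf neq_lk) mulr0.
by rewrite mxE /evol_basis_mul eq_sym (negPf neq_ji) mxE mulr0.
Qed.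

Lemma bilinear_form_eq (K : fieldType) (n : nat) (P Q : 'I_n -> 'I_n -> K) :
  (forall u v : 'rV[K]_n, \sum_i \sum_j u 0 i * v 0 j * P i j =
                          \sum_i \sum_j u 0 i * v 0 j * Q i j) ->
  P =2 Q.
Proof.
move=> eqPQ i j.
have val_delta (B : 'I_n -> 'I_n -> K) :
    \sum_k \sum_l (evol_basis K i) 0 k * (evol_basis K j) 0 l * B k l = B i j.
  rewrite (bigD1 i) //= (bigD1 j) //= !mxE !eqxx !mul1r.
  rewrite !big1 ?addr0 // => [k neq_ki | l neq_lj].
    by apply: big1 => l _; rewrite !mxE (negPf neq_ki) /= !mul0r.
  by rewrite !mxE (negPf neq_lj) andbF mulr0 mul0r.
by rewrite -val_delta eqPQ val_delta.
Qed.

(** The Leibniz rule is an equality of two bilinear maps; the k-th coordinates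
    of their values at e_i, e_j are the two sides below.  The case i = j has the
    square of e_i on the left, and both terms on the right coincide. *)
Lemma derivation_bilinP (K : fieldType) (n : nat) (e : rel 'I_n)
    (d : {linear 'rV[K]_n -> 'rV[K]_n}) :
  symmetric e ->
  derivation e d <->
  forall i j k : 'I_n,
    (if i == j then \sum_l (e i l)%:R * lin1_mx d l k else 0) =
    lin1_mx d i j * (e j k)%:R + lin1_mx d j i * (e i k)%:R.
Proof.
move=> sym_e; set D := lin1_mx d.
have dE u k : d u 0 k = \sum_i u 0 i * D i k by rewrite -mul_rV_lin1 mxE.
have lhsE (u v : 'rV[K]_n) k : d (evol_mul e u v) 0 k =
    \sum_i \sum_j u 0 i * v 0 j *
      (if i == j then \sum_l (e i l)%:R * D l k else 0).
  rewrite dE; under eq_bigr do rewrite evol_mulE // mulr_suml.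
  rewrite exchange_big /=; apply: eq_bigr => i _.
  rewrite [RHS](bigD1 i) //= eqxx [X in _ = _ + X]big1 ?addr0 => [|j neq_ji].
    by rewrite mulr_sumr; apply: eq_bigr => l _; rewrite mulrA.
  by rewrite eq_sym (negPf neq_ji) mulr0.
have rhsE (u v : 'rV[K]_n) k :
    (evol_mul e (d u) v + evol_mul e u (d v)) 0 k =
    \sum_i \sum_j u 0 i * v 0 j * (D i j * (e j k)%:R + D j i * (e i k)%:R).
  rewrite mxE !evol_mulE //.
  under eq_bigr => j _ do rewrite dE !mulr_suml.
  rewrite exchange_big /= -big_split /=; apply: eq_bigr => i _.
  rewrite dE mulr_sumr mulr_suml -big_split /=; apply: eq_bigr => j _.
  by rewrite mulrDr !mulrA; congr (_ * _ + _); rewrite mulrAC.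
split=> [der i j k | eq_coef u v].
  apply: (bilinear_form_eq
    (P := fun i j => if i == j then \sum_l (e i l)%:R * D l k else 0)
    (Q := fun i j => D i j * (e j k)%:R + D j i * (e i k)%:R)) => u v.
  by rewrite -rhsE -der lhsE.
apply/rowP => k; rewrite lhsE rhsE.
by apply: eq_bigr => i _; apply: eq_bigr => j _; rewrite eq_coef.
Qed.

Lemma derivation_coordP (K : fieldType) (n : nat) (e : rel 'I_n)
    (d : {linear 'rV[K]_n -> 'rV[K]_n}) :
  symmetric e ->
  derivation e d <->
  (forall i j k : 'I_n, i != j ->
     lin1_mx d i j * (e j k)%:R + lin1_mx d j i * (e i k)%:R = 0) /\
  (forall i k,
     \sum_(l | e i l) lin1_mx d l k = 2 * lin1_mx d i i * (e i k)%:R).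
Proof.
move=> sym_e.
have sumE i k : \sum_(l | e i l) lin1_mx d l k =
    \sum_l (e i l)%:R * lin1_mx d l k.
  rewrite big_mkcond; apply: eq_bigr => l _.
  by case: (e i l); rewrite ?mul1r ?mul0r.
split=> [/(derivation_bilinP d sym_e) H | [Hne Heq]].
  split=> [i j k neq_ij | i k]; first by rewrite -H (negPf neq_ij).
  by rewrite sumE; have := H i i k; rewrite eqxx => ->; rewrite -mulrDl mulr_natl.
apply/(derivation_bilinP d sym_e) => i j k.
by case: eqP => [<- | /eqP/Hne //]; rewrite -sumE Heq mulr_natl mulr2n mulrDl.
Qed.

(** * Derivations and twin classes *)

(** The sum over N(i) is the whole twin class of k or empty because k and its
    twins have the same neighbors, so that N(i) contains all or none of them. *)
Lemma sum_neighbors_twin_support (K : fieldType) (n : nat) (e : rel 'I_n)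
    (D : 'M[K]_n) (i k : 'I_n) :
  symmetric e -> (forall l k, ~~ twins e l k -> D l k = 0) ->
  \sum_(l | e i l) D l k = (\sum_(l in twin_class e k) D l k) * (e i k)%:R.
Proof.
move=> sym_e supp_D; rewrite mulr_suml [LHS]big_mkcond [RHS]big_mkcond /=.
apply: eq_bigr => l _; rewrite inE twins_sym; case: ifPn => [e_il|].
  case: ifPn => [/twinsP tw_lk|/supp_D-> //].
  by rewrite sym_e -tw_lk sym_e e_il mulr1.
case: ifP => // /twinsP tw_lk /negPf e_il.
by rewrite sym_e -tw_lk sym_e e_il mulr0.
Qed.

Lemma derivation_twinP (K : fieldType) (n : nat) (e : rel 'I_n)
    (d : {linear 'rV[K]_n -> 'rV[K]_n}) :
  symmetric e -> (forall i, exists k, e i k) ->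
  derivation e d <->
  [/\ forall i j, ~~ twins e i j -> lin1_mx d i j = 0,
      forall i j, twins e i j -> i != j -> lin1_mx d i j = - lin1_mx d j i
    & forall i j, e i j ->
        \sum_(k in twin_class e j) lin1_mx d k j = 2 * lin1_mx d i i].
Proof.
move=> sym_e nbr; set D := lin1_mx d.
split=> [/(derivation_coordP d sym_e)[Hne Heq] | [supp_D skew_D sum_D]].
  (* A vertex adjacent to i but not to j kills D j i, then a neighbor of j
     kills D i j. *)
  have both0 i j k : e i k -> ~~ e j k -> D i j = 0 /\ D j i = 0.
    move=> e_ik /negPf e_jk.
    have neq_ij : i != j by apply: contraFneq e_jk => <-.
    have Dji0: D j i = 0.
      by have := Hne i j k neq_ij; rewrite e_ik e_jk mulr0 add0r mulr1.
    split=> //; have [l e_jl] := nbr j.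
    by have := Hne i j l neq_ij; rewrite e_jl -/D Dji0 mul0r addr0 mulr1.
  have supp_D i j : ~~ twins e i j -> D i j = 0.
    move=> ntw_ij; have [k] : exists k, e i k != e j k.
      apply/existsP; rewrite -negb_forall; apply: contra ntw_ij => /forallP eqN.
      by apply/twinsP => k; apply/eqP.
    case e_ik: (e i k); case e_jk: (e j k) => // _.
      by case: (both0 i j k) => //; rewrite e_jk.
    by case: (both0 j i k) => //; rewrite e_ik.
  split=> // [i j /twinsP tw_ij neq_ij | i j e_ij].
    have [k e_ik] := nbr i; have := Hne i j k neq_ij.
    by rewrite -tw_ij e_ik !mulr1 => /eqP; rewrite addr_eq0 => /eqP.
  by have := Heq i j; rewrite sum_neighbors_twin_support // e_ij !mulr1.
apply/(derivation_coordP d sym_e); split=> [i j k neq_ij | i k].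
  case: (boolP (twins e i j)) => [tw_ij | ntw_ij].
    by rewrite -/D (skew_D _ _ tw_ij neq_ij) (twinsP _ _ _ tw_ij) mulNr addNr.
  by rewrite -/D (supp_D i j) // (supp_D j i) ?mul0r ?addr0 // twins_sym.
rewrite sum_neighbors_twin_support //.
by case e_ik: (e i k); rewrite ?mulr0 // !mulr1 (sum_D i).
Qed.

(** * Block-diagonal matrices *)

Lemma skew_zero_diagP (K : fieldType) (u : nat) (C : 'M[K]_u) :
  skew_symmetric (zero_diag C) <-> forall a b, a != b -> C a b = - C b a.
Proof.
split=> [/matrixP skew_C a b neq_ab | skew_C].
  by have := skew_C b a; rewrite !mxE [b == a]eq_sym (negPf neq_ab).
apply/matrixP => a b; rewrite !mxE eq_sym.
by case: eqVneq => [_|neq_ab]; rewrite ?oppr0 // skew_C // eq_sym.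
Qed.

Definition block_index (m N : nat) (p_ : 'I_m -> nat)
    (sum_p : (\sum_(i < m) p_ i)%N = N) (i : 'I_m) (a : 'I_(p_ i)) : 'I_N :=
  cast_ord sum_p (tagnat.Rank i a).

Lemma block_indexE (m N : nat) (p_ : 'I_m -> nat)
    (sum_p : (\sum_(i < m) p_ i)%N = N) (i : 'I_m) (a : 'I_(p_ i)) :
  block_index sum_p a = (\sum_(l < m | (l < i)%N) p_ l + a)%N :> nat.
Proof. exact: tagnat.RankEsum. Qed.

Lemma block_index_surj (m N : nat) (p_ : 'I_m -> nat)
    (sum_p : (\sum_(i < m) p_ i)%N = N) (v : 'I_N) :
  exists i a, v = block_index sum_p (i := i) a.
Proof.
exists (tagnat.sig1 (cast_ord (esym sum_p) v)), (tagnat.sig2 _).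
by rewrite /block_index tagnat.sig2K cast_ordKV.
Qed.

Lemma block_index_inj (m N : nat) (p_ : 'I_m -> nat)
    (sum_p : (\sum_(i < m) p_ i)%N = N) (i : 'I_m) :
  injective (@block_index m N p_ sum_p i).
Proof.
move=> a b /cast_ord_inj/(congr1 val)/eqP.
by rewrite /= tagnat.eq_Rank eqxx => /eqP/val_inj.
Qed.

Lemma castmx_mxdiag_entry (K : fieldType) (m N : nat) (p_ : 'I_m -> nat)
    (sum_p : (\sum_(i < m) p_ i)%N = N) (C : forall i : 'I_m, 'M[K]_(p_ i))
    (i : 'I_m) (a b : 'I_(p_ i)) :
  castmx (sum_p, sum_p) (\mxdiag_(i < m) C i)
    (block_index sum_p a) (block_index sum_p b) = C i a b.
Proof.
rewrite castmxE /= !cast_ordK.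
by have := congr1 (fun B : 'M_(p_ i) => B a b) (submxblock_diag C i); rewrite mxE.
Qed.

Lemma castmx_mxdiag_offdiag (K : fieldType) (m N : nat) (p_ : 'I_m -> nat)
    (sum_p : (\sum_(i < m) p_ i)%N = N) (C : forall i : 'I_m, 'M[K]_(p_ i))
    (i j : 'I_m) (a : 'I_(p_ i)) (b : 'I_(p_ j)) :
  i != j ->
  castmx (sum_p, sum_p) (\mxdiag_(i < m) C i)
    (block_index sum_p a) (block_index sum_p b) = 0.
Proof.
move=> neq_ij; rewrite castmxE /= !cast_ordK mxE ifN ?mxE //.
by rewrite !tagnat.Rank1K.
Qed.

(** * Twin classes as blocks *)

Lemma block_index_twin_class (n m : nat) (e : rel 'I_n) (c : 'I_m -> 'I_n)
    (reps_c : complete_twin_reps e c) (i : 'I_m) (a : 'I_(twin_size e c i)) :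
  twin_labeled e c ->
  block_index (sum_twin_size reps_c) a \in twin_class e (c i).
Proof.
move=> label_c; rewrite label_c inE block_indexE leq_addr /=.
have -> : twin_offset e c i.+1 = (twin_offset e c i + twin_size e c i)%N.
  rewrite /twin_offset (bigD1 i) //= addnC; congr (_ + _)%N.
  by apply: eq_bigl => l; rewrite ltnS [in RHS]ltn_neqAle -val_eqE andbC.
by rewrite ltn_add2l.
Qed.

Lemma twins_block_index (n m : nat) (e : rel 'I_n) (c : 'I_m -> 'I_n)
    (reps_c : complete_twin_reps e c) (i j : 'I_m)
    (a : 'I_(twin_size e c i)) (b : 'I_(twin_size e c j)) :
  twin_labeled e c ->
  twins e (block_index (sum_twin_size reps_c) a)
          (block_index (sum_twin_size reps_c) b) = (i == j).
Proof.
move=> label_c; have := block_index_twin_class reps_c a label_c.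
have := block_index_twin_class reps_c b label_c.
set v := block_index _ a; set w := block_index _ b.
rewrite !inE => tw_w tw_v; apply/idP/eqP => [tw_vw | eq_ij].
  have [k [_ uniq_k]] := reps_c w.
  rewrite -(uniq_k i); first by apply: uniq_k; rewrite inE.
  by rewrite inE (twins_trans tw_v).
by rewrite -eq_ij in tw_w; apply: twins_trans tw_w; rewrite twins_sym.
Qed.

(** * Derivations as block matrices *)

Theorem theorem3p1 (K : fieldType) (charK : exists p : nat, p \in [pchar K])
    (n m : nat) (n_ge3 : (3 <= n)%N)
    (e : rel 'I_n) (simple_e : simple_graph e) (conn_e : connected_graph e)
    (c : 'I_m -> 'I_n) (reps_c : complete_twin_reps e c)
    (label_c : twin_labeled e c)
    (d : {linear 'rV[K]_n -> 'rV[K]_n}) :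
  derivation e d <->
  exists C : forall i : 'I_m, 'M[K]_(twin_size e c i),
    [/\ lin1_mx d = castmx (sum_twin_size reps_c, sum_twin_size reps_c)
                      (\mxdiag_(i < m) C i),
        forall (i : 'I_m) (j : 'I_n), j \in twin_class e (c i) ->
          forall t : 'I_n, t \in set_neighbors e (twin_class e (c i)) ->
            \sum_(k in twin_class e (c i)) lin1_mx d k j = 2 * lin1_mx d t t
      & forall i : 'I_m, skew_symmetric (zero_diag (C i))].
Proof.
have [sym_e _] := simple_e.
have nbr i := connected_neighbor i (ltnW n_ge3) conn_e.
set bi := block_index (sum_twin_size reps_c).
have class_eq i j : twins e i j -> twin_class e i = twin_class e j.
  by move=> /eqP tw_ij; apply/setP => k; rewrite !inE /twins tw_ij.
split=> [/(derivation_twinP d sym_e nbr)[supp_D skew_D sum_D] | ].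
  pose C i : 'M_(twin_size e c i) := \matrix_(a, b) lin1_mx d (bi i a) (bi i b).
  exists C; split=> [|i j|i].
  - apply/matrixP => v w.
    have [i [a ->]] := block_index_surj (sum_twin_size reps_c) v.
    have [j [b ->]] := block_index_surj (sum_twin_size reps_c) w.
    have [eq_ij|neq_ij] := eqVneq i j.
      by subst j; rewrite castmx_mxdiag_entry [RHS]mxE.
    by rewrite castmx_mxdiag_offdiag // supp_D // twins_block_index.
  - rewrite inE => tw_j t; rewrite (set_neighbors_twin_class _ tw_j) => e_jt.
    by rewrite (class_eq _ _ tw_j) (sum_D t) // sym_e.
  - apply/skew_zero_diagP => a b neq_ab; rewrite mxE [in RHS]mxE.
    apply: skew_D; first by rewrite twins_block_index.
    by rewrite (inj_eq (@block_index_inj _ _ _ _ _)).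
case=> C [D_def sum_D skew_C]; apply/(derivation_twinP d sym_e nbr).
split=> [v w | v w | t j e_tj].
- have [i [a ->]] := block_index_surj (sum_twin_size reps_c) v.
  have [j [b ->]] := block_index_surj (sum_twin_size reps_c) w.
  by rewrite twins_block_index // D_def => /castmx_mxdiag_offdiag->.
- have [i [a ->]] := block_index_surj (sum_twin_size reps_c) v.
  have [j [b ->]] := block_index_surj (sum_twin_size reps_c) w.
  rewrite twins_block_index // => /eqP eq_ij; subst j.
  rewrite (inj_eq (@block_index_inj _ _ _ _ _)) => neq_ab.
  rewrite D_def !castmx_mxdiag_entry.
  by have /skew_zero_diagP skew_Ci := skew_C i; apply: skew_Ci.
- have [i [tw_j _]] := reps_c j.
  have := tw_j; rewrite inE => /[dup] tw_ij /class_eq <-.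
  by apply: sum_D; rewrite ?(set_neighbors_twin_class _ tw_ij) // sym_e.
Qed.
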